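(* $\displaystyle \liminf_{n\to\infty}\frac{p(n,3)}{s(n,3)} > 1.$
   Context: $p(n,3)$ denotes the number of paving matroids of rank $3$ on the ground set $[n]=\{1,\dots,n\}$ (rank-$3$ matroids all of whose circuits have at least $3$ elements), and $s(n,3)$ denotes the number of sparse paving matroids of rank $3$ on $[n]$ (rank-$3$ matroids in which every $3$-subset of $[n]$ is either a basis or a circuit-hyperplane). *)

(* Defs.v *)
From HB Require Import structures.
From mathcomp Require Import all_boot all_order all_algebra.
Set Implicit Arguments. Unset Strict Implicit. Unset Printing Implicit Defensive.

(* A matroid on the ground set 'I_n = {0,...,n-1} (a labeled copy of [n])
   is given by its set of bases, subject to the basis axioms. *)
Section Matroid.
Variable n : nat.
Implicit Types (Bs : {set {set 'I_n}}) (X : {set 'I_n}).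

Definition is_matroid_bases Bs : bool :=
  (Bs != set0) &&
  [forall B1 in Bs, forall B2 in Bs, forall x in B1 :\: B2,
     exists y in B2 :\: B1, ((B1 :\ x) :|: [set y]) \in Bs].

Definition has_rank Bs (r : nat) : bool := [forall B in Bs, #|B| == r].

Definition indep Bs X : bool := [exists B in Bs, X \subset B].

Definition rk Bs X : nat := \max_(I : {set 'I_n} | (I \subset X) && indep Bs I) #|I|.

Definition circuit Bs X : bool :=
  ~~ indep Bs X && [forall x in X, indep Bs (X :\ x)].

Definition flat Bs X : bool := [forall x in ~: X, rk Bs X < rk Bs (x |: X)].

Definition hyperplane Bs (r : nat) X : bool := flat Bs X && (rk Bs X == r.-1).

Definition circuit_hyperplane Bs r X : bool := circuit Bs X && hyperplane Bs r X.

Definition paving Bs (r : nat) : bool := [forall C : {set 'I_n}, circuit Bs C ==> (r <= #|C|)].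

Definition sparse_paving Bs (r : nat) : bool :=
  [forall X : {set 'I_n}, (#|X| == r) ==> ((X \in Bs) || circuit_hyperplane Bs r X)].
End Matroid.

Definition p_count (n r : nat) : nat :=
  #|[set Bs : {set {set 'I_n}} | [&& is_matroid_bases Bs, has_rank Bs r & paving Bs r]]|.

Definition s_count (n r : nat) : nat :=
  #|[set Bs : {set {set 'I_n}} | [&& is_matroid_bases Bs, has_rank Bs r & sparse_paving Bs r]]|.

(* Main.v *)
(** Paving matroids of rank 3 are families of lines pairwise meeting in at most
    one point, and sparse paving ones are those whose lines all have size 3.
    Let [P] be the number of partial triple systems on [n] points and [Q] the
    number of such families with exactly one line of size 4, the others having
    size 3; then [s <= P] and [P + Q <= p], so it is enough that [P = O(Q)].
    - Adding an addable triple and removing a triple are inverse to each other,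
      and a system [S] leaves at least [C(n, 3) - 3 n |S|] triples addable;
      hence the average of [|S|] is at least of order [n ^ 2].
    - Given a triple [X] of [S] and a point [d] off [X], delete the at most three
      triples joining [d] to [X] and replace [X] by [d |: X].  Each result
      arises at most [4 n ^ 3] times, so [(n - 3) * sum |S| <= 4 n ^ 3 * Q]. *)
Require Import Defs.
From HB Require Import structures.
From mathcomp Require Import all_boot zify.

(** * Linear families and the paving matroids they define *)

Section LinearFamilies.
Set Implicit Arguments. Unset Strict Implicit. Unset Printing Implicit Defensive.
Variable n : nat.
Implicit Types (L S : {set {set 'I_n}}) (X Y B : {set 'I_n}).

Definition linear L : bool :=
  [forall X in L, forall Y in L, (X != Y) ==> (#|X :&: Y| <= 1)].

(** Lines are proper so that some triple is always a basis. They have at least 3 points because a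
    smaller set contains no triple and would leave no trace in [line_bases L]. *)
Definition lines L : bool := linear L && [forall X in L, 3 <= #|X| < n].

Definition line_bases L : {set {set 'I_n}} :=
  [set B : {set 'I_n} | (#|B| == 3) && [forall X in L, ~~ (B \subset X)]].

Lemma linearP L :
  reflect {in L &, forall X Y, X != Y -> #|X :&: Y| <= 1} (linear L).
Proof.
apply: (iffP 'forall_in_'forall_in_implyP) => H X; last by move=> XL Y; apply: H.
by move=> Y XL YL; apply: H.
Qed.

Lemma linear_eq L X Y (P : {set 'I_n}) :
  linear L -> X \in L -> Y \in L -> 1 < #|P| -> P \subset X -> P \subset Y -> X = Y.
Proof.
move=> /linearP lin XL YL P2 PX PY; apply/eqP; apply: contraLR P2 => neq.
rewrite -leqNgt (leq_trans _ (lin X Y XL YL neq)) //.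
by rewrite subset_leq_card // subsetI PX.
Qed.

Lemma linearS L L' : L \subset L' -> linear L' -> linear L.
Proof. by move=> /subsetP s /linearP lin; apply/linearP=> X Y /s ? /s ?; apply: lin. Qed.

Lemma linearU1 X L :
  linear L -> {in L, forall Y, #|X :&: Y| <= 1} -> linear (X |: L).
Proof.
move=> /linearP lin H; apply/linearP=> Y Z /setU1P[->|YL] /setU1P[->|ZL] neq.
- by rewrite eqxx in neq.
- exact: H.
- by rewrite setIC; apply: H.
- exact: lin.
Qed.

Lemma mem_line_bases L B :
  reflect (#|B| = 3 /\ {in L, forall X, ~~ (B \subset X)}) (B \in line_bases L).
Proof.
rewrite inE; apply: (iffP andP) => [[/eqP B3 /forall_inP]|[-> H]]; first by split.
by split=> //; apply/forall_inP.
Qed.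

Lemma card_subset_exists X k : k <= #|X| -> exists2 Y : {set 'I_n}, Y \subset X & #|Y| = k.
Proof.
rewrite -bin_gt0 -(cards_draws X k) card_gt0 => /set0Pn[Y].
by rewrite inE => /andP[YX /eqP <-]; exists Y.
Qed.

Lemma card_superset_exists X k :
  #|X| <= k <= n -> exists2 Y : {set 'I_n}, X \subset Y & #|Y| = k.
Proof.
move=> /andP[Xk kn].
have [|Y YX Yc] := @card_subset_exists (~: X) (k - #|X|).
  by have := cardsC X; rewrite card_ord; lia.
exists (X :|: Y); first exact: subsetUl.
rewrite cardsU Yc (_ : X :&: Y = set0) ?cards0; first lia.
by apply/eqP; rewrite setI_eq0 disjoint_sym disjoints_subset.
Qed.

Lemma line_bases_extend L (P : {set 'I_n}) :
  2 < n -> lines L -> #|P| <= 2 -> exists2 B : {set 'I_n}, B \in line_bases L & P \subset B.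
Proof.
move=> n2 /andP[lin /forall_inP szL] P2.
have [|P' PP' P'2] := @card_superset_exists P 2; first by rewrite P2 ltnW.
(* [Z] is the line through [P'], or [P'] itself if no line contains it; any point off [Z] completes
   [P'] to a basis. *)
suff [Z PZ [Zn ZL]] : exists2 Z : {set 'I_n}, P' \subset Z &
    #|Z| < n /\ {in L, forall Y, P' \subset Y -> Y \subset Z}.
  have : #|~: Z| > 0 by have := cardsC Z; rewrite card_ord; lia.
  rewrite card_gt0 => /set0Pn[z]; rewrite inE => zZ.
  have zP : z \notin P' by apply: contraNN zZ; apply: (subsetP PZ).
  exists (z |: P'); last by rewrite (subset_trans PP') ?subsetUr.
  apply/mem_line_bases; split=> [|Y YL]; first by rewrite cardsU1 zP P'2.
  apply: contraNN zZ; rewrite subUset sub1set => /andP[zY PY].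
  by apply: subsetP zY; apply: ZL.
have [/exists_inP[X XL PX]|] := boolP [exists X in L, P' \subset X].
  exists X => //; split=> [|Y YL PY]; first by case/andP: (szL X XL).
  by rewrite (linear_eq lin YL XL _ PY PX) // P'2.
rewrite negb_exists_in => /forall_inP H; exists P' => //; rewrite P'2.
by split=> // Y YL PY; have := H Y YL; rewrite PY.
Qed.

(** Paving holds because every set of at most two points extends to a basis. For exchange, if no [y]
    can replace [x], each [y] in [B2 :\: B1] lies on a line through the pair [B1 :\ x]. By linearity
    these lines coincide, and that one line contains [B2], which is absurd. *)
Lemma line_bases_matroid L : 2 < n -> lines L ->
  [&& is_matroid_bases (line_bases L), has_rank (line_bases L) 3
    & paving (line_bases L) 3].
Proof.
move=> n2 Ll; have [lin szL] := andP Ll.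
apply/and3P; split; last 1 first.
- apply/forallP=> C; apply/implyP=> /andP[/negP nC _]; rewrite leqNgt; apply/negP=> C2.
  have [B BL CB] := line_bases_extend n2 Ll C2.
  by apply: nC; apply/exists_inP; exists B.
- apply/andP; split.
    have [|B BL _] := @line_bases_extend L set0 n2 Ll; first by rewrite cards0.
    by apply/set0Pn; exists B.
  apply/forall_inP=> B1 /mem_line_bases[B13 B1L].
  apply/forall_inP=> B2 /mem_line_bases[B23 B2L].
  apply/forall_inP=> x /setDP[xB1 xB2]; rewrite -[X in is_true X]negbK; apply/negP.
  rewrite negb_exists_in => /forall_inP H.
  set P := B1 :\ x in H; have P2 : #|P| = 2.
    by apply/eqP; rewrite -(eqn_add2l (x \in B1)) -cardsD1 xB1 B13.
  have ext y : y \in B2 :\: B1 -> exists2 X, X \in L & y |: P \subset X.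
    move=> yB; have := H y yB; rewrite inE setUC cardsU1.
    have /setDP[yB2 yB1] := yB; rewrite {1}/P inE (negbTE yB1) andbF P2 eqxx /=.
    by rewrite negb_forall_in => /exists_inP[X XL]; rewrite negbK; exists X.
  have /set0Pn[y0 y0B] : B2 :\: B1 != set0.
    rewrite setD_eq0; apply: contraNN xB2 => B21.
    suff /eqP-> : B2 == B1 by [].
    by rewrite eqEcard B21 B13 B23.
  have [X0 X0L] := ext y0 y0B; rewrite subUset => /andP[_ PX0].
  have /negP[] := B2L X0 X0L; apply/subsetP=> y yB2.
  have [yB1|yB1] := boolP (y \in B1).
    by apply: (subsetP PX0); rewrite !inE yB1 andbT; apply: contraNneq xB2 => <-.
  have [|X XL] := ext y; first by rewrite inE yB1.
  rewrite subUset sub1set => /andP[yX PX].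
  by rewrite (linear_eq lin X0L XL _ PX0 PX) // P2.
- by apply/forall_inP=> B /mem_line_bases[->].
Qed.

(** Every triple in [X] is a nonbasis, so it lies on a line of [L']. Fix a pair in [X]: all lines of
    [L'] through it are the same, and this line swallows [X]. *)
Lemma line_bases_sub L L' X : lines L' -> line_bases L = line_bases L' ->
  X \in L -> 2 < #|X| -> exists2 X' : {set 'I_n}, X' \in L' & X \subset X'.
Proof.
move=> /andP[lin' _] eqB XL X3.
have trip (T : {set 'I_n}) : T \subset X -> #|T| = 3 -> exists2 Y, Y \in L' & T \subset Y.
  move=> TX T3; have : T \notin line_bases L'.
    by rewrite -eqB inE T3 negb_forall_in; apply/exists_inP; exists X; rewrite ?negbK.
  rewrite inE T3 negb_forall_in => /exists_inP[Y YL]; rewrite negbK.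
  by exists Y.
have [P PX P2] := card_subset_exists (ltnW X3).
have ext y : y \in X -> y \notin P -> exists2 Y, Y \in L' & y |: P \subset Y.
  by move=> yX yP; apply: trip; rewrite ?subUset ?sub1set ?yX // cardsU1 yP P2.
have /set0Pn[y0 /setDP[y0X y0P]] : X :\: P != set0.
  by rewrite setD_eq0; apply: contraL X3 => /subset_leq_card; rewrite P2 -leqNgt.
have [Y YL' ] := ext y0 y0X y0P; rewrite subUset => /andP[_ PY].
exists Y => //; apply/subsetP=> y yX.
have [|yP] := boolP (y \in P); first exact: (subsetP PY).
have [Z ZL'] := ext y yX yP; rewrite subUset sub1set => /andP[yZ PZ].
by rewrite (linear_eq lin' YL' ZL' _ PY PZ) // P2.
Qed.

Lemma line_bases_inj : {in [set L | lines L] &, injective line_bases}.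
Proof.
move=> L L'; rewrite !inE => Ll Ll' eqB.
wlog suff sub : L L' Ll Ll' eqB / L \subset L'.
  by apply/eqP; rewrite eqEsubset !sub.
have [[lin /forall_inP szL] [_ /forall_inP szL']] := (andP Ll, andP Ll').
apply/subsetP=> X XL; have /andP[X3 _] := szL X XL.
have [Y YL' XY] := line_bases_sub Ll' eqB XL X3.
have /andP[Y3 _] := szL' Y YL'.
(* Going back from [L'] to [L] gives [X \subset Y \subset Z] with [X] and [Z] both in [L]; linearity
   forces [X = Z]. *)
have [Z ZL YZ] := line_bases_sub Ll (esym eqB) YL' Y3.
have XZ : X = Z by apply: (linear_eq lin XL ZL (ltnW X3)) (subset_trans XY YZ).
by rewrite (_ : X = Y) //; apply/eqP; rewrite eqEsubset XY XZ.
Qed.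

Lemma card_lines_le_p_count : 2 < n -> #|[set L | lines L]| <= p_count n 3.
Proof.
move=> n2; rewrite -(card_in_imset line_bases_inj); apply/subset_leq_card/subsetP.
by move=> Bs /imsetP[L]; rewrite inE => Ll ->; rewrite inE line_bases_matroid.
Qed.

(** * Sparse paving matroids as partial triple systems *)

Definition triple_systems : {set {set {set 'I_n}}} :=
  [set S | linear S && [forall X in S, #|X| == 3]].

Lemma triple_systemsP S :
  reflect (linear S /\ {in S, forall X, #|X| = 3}) (S \in triple_systems).
Proof.
rewrite inE; apply: (iffP andP) => -[lin H]; split=> //.
  by move=> X /(forall_inP H)/eqP.
by apply/forall_inP=> X /H/eqP.
Qed.

(** Suppose nonbases [X] and [Y] share a pair. The pair lies in a basis [B2], and [y |: X] contains
    a basis [B] for [y] in [Y] off [X]. Exchanging the third point of [B2] for a point of [B] would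
    make [X] or [Y] a basis. *)
Lemma nonbases_triple_system (Bs : {set {set 'I_n}}) :
  is_matroid_bases Bs -> has_rank Bs 3 -> sparse_paving Bs 3 ->
  [set X : {set 'I_n} | #|X| == 3] :\: Bs \in triple_systems.
Proof.
move=> /andP[_ exch] /forall_inP rk3 /forallP sp.
have nb (X : {set 'I_n}) : X \in [set X : {set 'I_n} | #|X| == 3] :\: Bs ->
    [/\ #|X| = 3, X \notin Bs & circuit_hyperplane Bs 3 X].
  rewrite !inE => /andP[XB /eqP X3]; split=> //.
  by have := sp X; rewrite X3 eqxx (negbTE XB).
apply/triple_systemsP; split; last by move=> X /nb[].
apply/linearP=> X Y /nb[X3 XB /andP[/andP[_ circ] /andP[/forall_inP flatX /eqP rkX]]].
move=> /nb[Y3 YB _] neq; rewrite leqNgt; apply/negP=> XY.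
have /set0Pn[x /setDP[xX xY]] : X :\: Y != set0.
  by rewrite setD_eq0; apply: contraNN neq => XsubY; rewrite eqEcard XsubY X3 Y3.
have /set0Pn[y /setDP[yY yX]] : Y :\: X != set0.
  by rewrite setD_eq0; apply: contraNN neq => YsubX; rewrite eq_sym eqEcard YsubX X3 Y3.
have defX : X = x |: (X :&: Y).
  apply/esym/eqP; rewrite eqEcard subUset sub1set xX subsetIl /=.
  by rewrite cardsU1 inE (negbTE xY) andbF X3.
have defY : Y = y |: (X :&: Y).
  apply/esym/eqP; rewrite eqEcard subUset sub1set yY subsetIr /=.
  by rewrite cardsU1 inE (negbTE yX) Y3.
have XY2 : #|X :&: Y| = 2.
  by have := X3; rewrite {1}defX cardsU1 inE (negbTE xY) andbF => -[].
(* [X] is a flat of rank 2, so adding [y] raises the rank to 3. *)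
have [B BBs BXY] : exists2 B, B \in Bs & B \subset y |: X.
  have := flatX y; rewrite inE => /(_ yX); rewrite rkX => rk2.
  have : ~~ (rk Bs (y |: X) <= 2) by rewrite -ltnNge.
  move=> /bigmax_leqP H.
  have [/exists_inP[B BBs BXY]|] := boolP [exists B in Bs, B \subset y |: X].
    by exists B.
  rewrite negb_exists_in => /forall_inP nB; case: H => I /andP[IXY /exists_inP[B BBs IB]].
  rewrite leqNgt; apply/negP => I3; have /negP[] := nB B BBs.
  suff <- : I = B by [].
  by apply/eqP; rewrite eqEcard IB (eqP (rk3 B BBs)).
have /exists_inP[B2 B2Bs XYB2] : indep Bs (X :&: Y).
  have /exists_inP[B2 B2Bs H] := forall_inP circ x xX.
  apply/exists_inP; exists B2 => //; apply: subset_trans H.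
  by rewrite subsetD1 subsetIl inE (negbTE xY) andbF.
have /set0Pn[c /setDP[cB2 cXY]] : B2 :\: (X :&: Y) != set0.
  rewrite setD_eq0; apply/negP=> /subset_leq_card.
  by rewrite XY2 (eqP (rk3 _ B2Bs)).
have defB2 : B2 = c |: (X :&: Y).
  apply/esym/eqP; rewrite eqEcard subUset sub1set cB2 XYB2 /=.
  by rewrite cardsU1 cXY XY2 (eqP (rk3 _ B2Bs)).
(* Besides the common pair, [y |: X] contains only [x] and [y], and these complete the pair to [X]
   and [Y]. *)
have key z : z \in y |: X -> z \notin X :&: Y -> z |: (X :&: Y) \notin Bs.
  move=> zXY; have : z \in y |: (x |: (X :&: Y)) by rewrite -defX.
  case/setU1P=> [->|/setU1P[->|->]] // _; by rewrite -?defX -?defY.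
have cB : c \notin B.
  apply: contraL B2Bs => cB; rewrite defB2; apply: key => //; exact: (subsetP BXY).
have cBB : c \in B2 :\: B by rewrite inE cB.
have /exists_inP[z /setDP[zB zB2]] :=
  forall_inP (forall_inP (forall_inP exch _ B2Bs) _ BBs) _ cBB.
apply/negP; rewrite (_ : B2 :\ c = X :&: Y).
  rewrite setUC; apply: key; first exact: (subsetP BXY).
  by apply: contraNN zB2; apply: (subsetP XYB2).
by rewrite defB2 setU1K.
Qed.

Lemma s_count_le_triple_systems : s_count n 3 <= #|triple_systems|.
Proof.
rewrite /s_count; set A := [set Bs | _].
have inj : {in A &, injective (fun Bs => [set X : {set 'I_n} | #|X| == 3] :\: Bs)}.
  have sub Bs : Bs \in A -> Bs \subset [set X : {set 'I_n} | #|X| == 3].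
    rewrite inE => /and3P[_ /forall_inP rk3 _].
    by apply/subsetP=> B BB; rewrite inE rk3.
  move=> B1 B2 /sub s1 /sub s2 /(congr1 (setD [set X : {set 'I_n} | #|X| == 3])).
  by rewrite !setDDr setDv !set0U (setIidPr s1) (setIidPr s2).
rewrite -(card_in_imset inj); apply/subset_leq_card/subsetP.
move=> _ /imsetP[Bs + ->]; rewrite inE => /and3P[].
exact: nonbases_triple_system.
Qed.

Lemma s_count_gt0 : 2 < n -> 0 < s_count n 3.
Proof.
(* The empty family of lines gives the uniform matroid. *)
move=> n2; rewrite card_gt0; apply/set0Pn; exists (line_bases set0).
have /(line_bases_matroid n2)/and3P[mat rk3 _] : lines set0.
  by apply/andP; split; first apply/linearP; try apply/forall_inP; move=> X; rewrite inE.
rewrite inE mat rk3; apply/forallP=> X; apply/implyP=> /eqP X3.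
by apply/orP; left; apply/mem_line_bases; split=> // Y; rewrite inE.
Qed.

(** * Systems with a single line of size 4 *)

Definition four_line_systems : {set {set {set 'I_n}}} :=
  [set L | [&& linear L, [forall X in L, (#|X| == 3) || (#|X| == 4)]
             & #|[set X in L | #|X| == 4]| == 1]].

(** Both kinds of systems are families of lines, [4 < n] making a line of size 4 proper; they are
    disjoint because a triple system has no member of size 4. *)
Lemma card_systems_le_p_count : 4 < n ->
  #|triple_systems| + #|four_line_systems| <= p_count n 3.
Proof.
move=> n4; apply: leq_trans (card_lines_le_p_count (ltnW (ltnW n4))).
rewrite -cardsUI (_ : _ :&: _ = set0) ?cards0 ?addn0.
  apply/subset_leq_card/subsetP=> L; rewrite inE => /orP[/triple_systemsP[lin L3]|].
    by rewrite inE /lines lin; apply/forall_inP=> X /L3 ->; rewrite (ltnW n4).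
  rewrite !inE => /and3P[lin /forall_inP L34 _]; rewrite /lines lin.
  by apply/forall_inP=> X /L34/orP[]/eqP->; rewrite ?(ltnW n4).
apply/setP=> L; rewrite in_setI in_set0; apply/andP=> -[/triple_systemsP[_ L3]].
rewrite inE => /and3P[_ _]; rewrite (_ : [set X in L | _] = set0) ?cards0 //.
by apply/setP=> X; rewrite !inE; apply/andP=> -[/L3 ->].
Qed.

(** * The average size of a triple system *)

Definition triples : {set {set 'I_n}} := [set X : {set 'I_n} | #|X| == 3].

Definition degree X := #|[set S in triple_systems | X \in S]|.

(** For a triple [X] this also excludes [X \in S], since [X] meets itself in 3 points. *)
Definition addable S X := [forall Y in S, #|X :&: Y| <= 1].

Lemma sum_degree : \sum_(S in triple_systems) #|S| = \sum_(X in triples) degree X.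
Proof.
transitivity (\sum_(S in triple_systems) \sum_(X in triples) (X \in S : nat)).
  apply: eq_bigr => S /triple_systemsP[_ S3].
  rewrite -sum1_card big_mkcond [RHS]big_mkcond; apply: eq_bigr => X _.
  by rewrite inE; case: ifP => [/S3->|_] //=; case: ifP.
rewrite exchange_big; apply: eq_bigr => X _; rewrite /degree -sum1_card.
rewrite big_mkcond [RHS]big_mkcond; apply: eq_bigr => S _.
by rewrite [in RHS]inE; case: (S \in _) => //=; case: (X \in S).
Qed.

Lemma card_addable_le X : #|X| = 3 ->
  #|[set S in triple_systems | addable S X]| <= degree X.
Proof.
move=> X3; set A := [set S in _ | _].
have nX S : S \in A -> X \notin S.
  by rewrite inE => /andP[_ /forall_inP H]; apply/negP=> /H; rewrite setIid X3.
have inj : {in A &, injective (setU [set X])}.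
  by move=> S S' /nX XS /nX XS' eqS; rewrite -(setU1K XS) eqS setU1K.
rewrite -(card_in_imset inj); apply/subset_leq_card/subsetP.
move=> _ /imsetP[S + ->]; rewrite inE => /andP[/triple_systemsP[lin S3] /forall_inP H].
rewrite inE setU11 andbT; apply/triple_systemsP; split; first exact: linearU1.
by move=> Y /setU1P[->|/S3].
Qed.

(** Such a triple is one of the 3 pairs of [Y] together with one of [n] points. *)
Lemma card_triples_meeting Y : #|Y| = 3 ->
  #|[set X in triples | 1 < #|X :&: Y|]| <= 3 * n.
Proof.
move=> Y3; set D := [set P : {set 'I_n} | P \subset Y & #|P| == 2].
have cD : #|setX D [set: 'I_n]| = 3 * n by rewrite cardsX cards_draws Y3 cardsT card_ord.
rewrite -cD; apply: leq_trans (leq_imset_card (fun p => p.2 |: p.1) _).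
apply/subset_leq_card/subsetP=> X; rewrite !inE => /andP[/eqP X3 XY].
have [P PXY P2] := card_subset_exists XY.
have [PX PY] : P \subset X /\ P \subset Y by apply/andP; rewrite -subsetI.
have /set0Pn[x /setDP[xX xP]] : X :\: P != set0.
  by rewrite setD_eq0; apply/negP=> /subset_leq_card; rewrite P2 X3.
apply/imsetP; exists (P, x); first by rewrite !inE PY P2.
by apply/esym/eqP; rewrite eqEcard subUset sub1set xX PX cardsU1 xP P2 X3.
Qed.

(** A triple that is not addable shares a pair with some member of [S]; apply the union bound over
    the members. *)
Lemma card_triples_le S : S \in triple_systems ->
  'C(n, 3) <= #|[set X in triples | addable S X]| + 3 * n * #|S|.
Proof.
move=> /triple_systemsP[_ S3].
have <- : #|triples| = 'C(n, 3) by rewrite card_draws card_ord.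
rewrite -(cardsID [set X | addable S X] triples) leq_add //.
  by apply/subset_leq_card/subsetP=> X; rewrite !inE.
rewrite mulnC -sum_nat_const.
apply: (@leq_trans (\sum_(Y in S) #|[set X in triples | 1 < #|X :&: Y|]|)); last first.
  by apply: leq_sum => Y /S3; apply: card_triples_meeting.
apply: (@leq_trans #|\bigcup_(Y in S) [set X in triples | 1 < #|X :&: Y|]|).
  apply/subset_leq_card/subsetP=> X; rewrite !inE negb_forall_in.
  move=> /andP[/exists_inP[Y YS XY] X3]; apply/bigcupP; exists Y => //.
  by rewrite !inE X3 ltnNge.
elim/big_rec2: _ => [|Y m U _ Um]; first by rewrite cards0.
by rewrite (leq_trans (leq_card_setU _ _)) ?leq_add2l.
Qed.

Lemma triple_systems_le_sum_degree :
  'C(n, 3) * #|triple_systems| <= (3 * n).+1 * \sum_(X in triples) degree X.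
Proof.
rewrite mulnC -sum_nat_const mulSn -{2}sum_degree big_distrr /=.
apply: (@leq_trans (\sum_(S in triple_systems) #|[set X in triples | addable S X]|
                    + \sum_(S in triple_systems) 3 * n * #|S|)).
  by rewrite -big_split; apply: leq_sum => S; apply: card_triples_le.
(* The remaining single copy of the degree sum bounds the addable pairs, counted by triple instead
   of by system. *)
rewrite leq_add2r.
have -> : \sum_(S in triple_systems) #|[set X in triples | addable S X]| =
          \sum_(X in triples) #|[set S in triple_systems | addable S X]|.
  under eq_bigr => S _ do rewrite -sum1dep_card big_mkcondr.
  by rewrite exchange_big; apply: eq_bigr => X _; rewrite -big_mkcondr sum1dep_card.
by apply: leq_sum => X; rewrite inE => /eqP; apply: card_addable_le.
Qed.

(** * Replacing a triple by a line of size 4 *)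

(* At most one line contains a given pair, so [S] is recovered from what is
   left after deleting that line and one more point. *)
Lemma card_delete_pair (P : {set 'I_n}) (A B : {set {set {set 'I_n}}}) :
  #|P| = 2 -> A \subset triple_systems ->
  (forall S, S \in A -> [set Y in S | ~~ (P \subset Y)] \in B) -> #|A| <= #|B| * n.
Proof.
move=> P2 /subsetP Ats AB.
pose rest S := [set Y in S | ~~ (P \subset Y)].
(* This is the member of [S] through [P], with default value [P] when there is none. Removing [P]
   from [[set line S]] discards the default, as [P] is too small to be in [S]. *)
pose line S := P :|: cover [set Y in S | P \subset Y].
have lineP S : S \in A -> (exists x, line S = P :|: [set x]) /\
    S = rest S :|: [set line S] :\ P.
  move=> /Ats/triple_systemsP[lin S3].
  have [/exists_inP[Y YS PY]|] := boolP [exists Y in S, P \subset Y].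
    have eqY Z : Z \in S -> P \subset Z -> Z = Y.
      by move=> ZS PZ; apply: (linear_eq lin ZS YS _ PZ PY); rewrite P2.
    have lineY : line S = Y.
      rewrite /line (_ : [set Z in S | _] = [set Y]); first by rewrite /cover big_set1; apply/setUidPr.
      by apply/setP=> Z; rewrite !inE; apply/andP/eqP => [[/eqY]|->].
    have YP : Y != P by apply/eqP=> YP; have := S3 Y YS; rewrite YP P2.
    split.
      have /set0Pn[y /setDP[yY yP]] : Y :\: P != set0.
        by rewrite setD_eq0; apply/negP=> /subset_leq_card; rewrite P2 S3.
      exists y; rewrite lineY setUC; apply/esym/eqP.
      by rewrite eqEcard subUset sub1set yY PY cardsU1 yP P2 S3.
    apply/setP=> Z; rewrite lineY !inE; have [-> |] := eqVneq Z Y.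
      by rewrite YS PY YP.
    rewrite andbF orbF => ZY; case ZS: (Z \in S) => //=.
    by apply/esym; apply: contraNN ZY => PZ; rewrite (eqY Z).
  rewrite negb_exists_in => /forall_inP nP.
  have lineE : line S = P.
    rewrite /line (_ : [set Z in S | _] = set0) /cover ?big_set0 ?setU0 //.
    by apply/setP=> Z; rewrite !inE; apply/andP=> -[/nP/negP].
  split; last first.
    rewrite lineE setDv setU0; apply/setP=> Z; rewrite inE.
    by case ZS: (Z \in S) => //=; rewrite nP.
  have /set0Pn[x xP] : P != set0 by rewrite -card_gt0 P2.
  by exists x; rewrite lineE; apply/esym/setUidPl; rewrite sub1set.
have inj : {in A &, injective (fun S => (rest S, line S))}.
  by move=> S S' /lineP[_ defS] /lineP[_ defS'] [eqr eql]; rewrite defS defS' eqr eql.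
apply: (@leq_trans #|setX B ((fun x => P :|: [set x]) @: [set: 'I_n])|).
  rewrite -(card_in_imset inj); apply/subset_leq_card/subsetP=> _ /imsetP[S SA ->].
  rewrite inE /= AB //; have [[x ->] _] := lineP S SA; exact: imset_f.
have := leq_imset_card (fun x => P :|: [set x]) [set: 'I_n].
by rewrite cardsX cardsT card_ord leq_mul2l => ->; rewrite orbT.
Qed.

(** The systems containing [X] in which no triple joins [d] to a point listed in [s]; the list form
    serves the induction that clears one point at a time. *)
Definition avoiding X d (s : seq 'I_n) : {set {set {set 'I_n}}} :=
  [set S in triple_systems | (X \in S) &&
     all (fun a => [forall Y in S, ~~ ([set a; d] \subset Y)]) s].

(** Each point [a] of [s] costs a factor [n], by deleting the triple through [a] and [d]. [X]
    survives because it does not contain [d]. *)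
Lemma degree_le_avoiding X d s : d \notin X -> {subset s <= X} ->
  degree X <= #|avoiding X d s| * n ^ size s.
Proof.
move=> dX; elim: s => [|a s IH] sX.
  by rewrite muln1 subset_leq_card //; apply/subsetP=> S; rewrite !inE andbT.
have {}IH : degree X <= #|avoiding X d s| * n ^ size s.
  by apply: IH => b bs; apply: sX; rewrite inE bs orbT.
apply: leq_trans IH _; rewrite expnS mulnA leq_mul2r; apply/orP; right.
have aX : a \in X by apply: sX; rewrite mem_head.
have ad : a != d by apply: contraNneq dX => <-.
apply: (@card_delete_pair [set a; d]); first by rewrite cards2 ad.
  by apply/subsetP=> S; rewrite inE => /andP[].
move=> S; rewrite inE => /and3P[/triple_systemsP[lin S3] XS /allP sS].
have sub : [set Y in S | ~~ ([set a; d] \subset Y)] \subset S.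
  by apply/subsetP=> Y; rewrite inE => /andP[].
rewrite inE; apply/and3P; split.
- apply/triple_systemsP; split; first exact: linearS sub lin.
  by move=> Y /(subsetP sub)/S3.
- by rewrite inE XS; apply: contra dX => /subsetP; apply; rewrite !inE eqxx orbT.
- rewrite /= ; apply/andP; split; first by apply/forall_inP=> Y; rewrite inE => /andP[].
  apply/allP=> b /sS /forall_inP H; apply/forall_inP=> Y YS.
  by apply: H; apply: (subsetP sub).
Qed.

Definition four_degree X := #|[set L in four_line_systems | X \in L]|.

(** Replace [X] by [d |: X]. A remaining triple through [d] has no point of [X], and any other meets
    [d |: X] where it meets [X], so linearity is kept. Since [X] and [d] are known, the step can be
    undone. *)
Lemma avoiding_le_four_degree X d : #|X| = 3 -> d \notin X ->
  #|avoiding X d (enum X)| <= four_degree (d |: X).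
Proof.
move=> X3 dX; set F := d |: X; have F4 : #|F| = 4 by rewrite cardsU1 dX X3.
have avP S : S \in avoiding X d (enum X) -> [/\ S \in triple_systems, X \in S, F \notin S
    & forall a Y, a \in X -> Y \in S -> a \in Y -> d \notin Y].
  rewrite inE => /and3P[St XS /allP avS]; split=> //.
    by apply/negP; case/triple_systemsP: St => _ S3 /S3; rewrite F4.
  move=> a Y aX YS aY; apply/negP=> dY.
  have /forall_inP/(_ Y YS) := avS a (etrans (mem_enum _ _) aX).
  by rewrite subUset !sub1set aY dY.
have inj : {in avoiding X d (enum X) &, injective (fun S => F |: S :\ X)}.
  move=> S S' /avP[_ XS FS _] /avP[_ XS' FS' _] /(congr1 (fun L => L :\ F)).
  by rewrite !setU1K ?inE ?(negbTE FS) ?(negbTE FS') ?andbF // => eqD;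
     rewrite -(setD1K XS) eqD setD1K.
rewrite -(card_in_imset inj); apply/subset_leq_card/subsetP=> _ /imsetP[S + ->].
move=> /avP[/triple_systemsP[lin S3] XS FS sep].
rewrite inE setU11 andbT inE; apply/and3P; split.
- apply: linearU1; first by apply: linearS lin; apply: subD1set.
  move=> Y /setD1P[YX YS].
  have XY : #|X :&: Y| <= 1 by apply: (linearP _ lin) => //; rewrite eq_sym.
  have [dY|dY] := boolP (d \in Y); last first.
    by rewrite /F setIUl (_ : [set d] :&: Y = set0) ?set0U //; apply/eqP;
       rewrite setI_eq0 disjoints1.
  rewrite -(cards1 d); apply/subset_leq_card/subsetP=> a; rewrite !inE.
  case/andP=> /orP[//|aX] aY; by have := sep a Y aX YS aY; rewrite dY.
- by apply/forall_inP=> Y /setU1P[->|/setD1P[_ /S3->]]; rewrite ?F4.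
- rewrite (_ : [set Y in _ | _] = [set F]) ?cards1 //; apply/setP=> Y; rewrite !inE.
  have [->|_] := eqVneq Y F; first by rewrite F4.
  by apply/andP=> -[/andP[_ /S3->]].
Qed.

Lemma degree_le_four_degree X d : #|X| = 3 -> d \notin X ->
  degree X <= n ^ 3 * four_degree (d |: X).
Proof.
move=> X3 dX; apply: leq_trans (degree_le_avoiding (s := enum X) dX _) _.
  by move=> a; rewrite mem_enum.
by rewrite -cardE X3 mulnC leq_mul2l avoiding_le_four_degree ?orbT.
Qed.

(** * Double counting and the comparison of the two families *)

Lemma sum_four_degree :
  \sum_(F : {set 'I_n} | #|F| == 4) four_degree F = #|four_line_systems|.
Proof.
rewrite /four_degree; under eq_bigr => F _ do rewrite -sum1dep_card big_mkcondr.
rewrite exchange_big -sum1_card; apply: eq_bigr => L.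
rewrite inE -big_mkcondr sum1dep_card => /and3P[_ _ /eqP L4].
by rewrite -[RHS]L4; apply: eq_card => F; rewrite !inE andbC.
Qed.

(** Pairs of a [k]-set and a point off it correspond to pairs of a [k.+1]-set and a point in it, so
    each [F] arises [k.+1] times. *)
Lemma sum_insert (g : {set 'I_n} -> nat) k :
  \sum_(X : {set 'I_n} | #|X| == k) \sum_(d | d \notin X) g (d |: X) =
  \sum_(F : {set 'I_n} | #|F| == k.+1) k.+1 * g F.
Proof.
rewrite (exchange_big_dep xpredT) //=.
transitivity (\sum_(d : 'I_n) \sum_(F : {set 'I_n} | (#|F| == k.+1) && (d \in F)) g F).
  apply: eq_bigr => d _; rewrite [RHS](reindex_onto (fun X => d |: X) (fun F => F :\ d)).
    apply: eq_bigl => X; rewrite setU11 andbT.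
    have [dX|dX] := boolP (d \in X).
      rewrite andbF; apply/esym/negbTE; rewrite negb_and; apply/orP; right.
      by apply: contraTneq dX => <-; rewrite setD11.
    by rewrite setU1K // eqxx cardsU1 dX !andbT.
  by move=> F /andP[_ dF]; rewrite setD1K.
rewrite (exchange_big_dep (fun F : {set 'I_n} => #|F| == k.+1)) /=; last by move=> d F _ /andP[].
apply: eq_bigr => F /eqP Fk; rewrite -Fk -sum_nat_const.
by apply: eq_bigl => d; rewrite Fk eqxx.
Qed.

Lemma sum_degree_le_four_line_systems :
  (n - 3) * \sum_(X in triples) degree X <= 4 * n ^ 3 * #|four_line_systems|.
Proof.
have -> : (n - 3) * \sum_(X in triples) degree X =
    \sum_(X : {set 'I_n} | #|X| == 3) \sum_(d | d \notin X) degree X.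
  rewrite big_distrr /=; apply: eq_big => X; first by rewrite inE.
  rewrite inE => /eqP X3; rewrite sum_nat_const; congr (_ * _).
  by have := cardC (mem X); rewrite X3 card_ord => {1}<-; rewrite addKn; apply: eq_card.
rewrite -sum_four_degree mulnAC mulnC big_distrr /= -sum_insert big_distrr /=.
apply: leq_sum => X /eqP X3; rewrite big_distrr /=.
by apply: leq_sum => d dX; apply: degree_le_four_degree.
Qed.

Lemma triple_systems_le_four_line_systems :
  11 < n -> #|triple_systems| <= 192 * #|four_line_systems|.
Proof.
move=> n11; have := triple_systems_le_sum_degree; have := sum_degree_le_four_line_systems.
move: (#|triple_systems|) (#|four_line_systems|) (\sum_(X in triples) degree X) => P Q s.
have := bin_ffact n 3; rewrite (_ : 3`! = 6) // !ffactnS ffactn0 muln1.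
case: n n11 => [|[|[|m]]] //= m11; set c := 'C(_, _) => defc dQ dP.
rewrite -(@leq_pmul2l (m.+3 ^ 4)) ?expn_gt0 //.
(* Here [m.+3] is the number of points. The constant is 192 = 2 * 6 * 4 * 4: this bound gives 2, the
   binomial coefficient 6, [3 * n + 1 <= 4 * n] gives 4, and the choice of the inserted point in a
   4-set gives 4. *)
have size4 : m.+3 ^ 4 <= 2 * (m.+3 * (m.+2 * m.+1)) * m by nia.
have : m.+3 * (m.+2 * m.+1) * m * P <= 24 * (m.+3 * (m * s)) by nia.
have : m.+3 * (m * s) <= 4 * m.+3 ^ 4 * Q by nia.
by nia.
Qed.
End LinearFamilies.

(** With P triple systems and Q four-line systems, 192 p >= 192 P + 192 Q >= 193 P >= 193 s. *)
Lemma p_count_ge n : 11 < n -> 193 * s_count n 3 <= 192 * p_count n 3.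
Proof.
move=> n11; have n4 : 4 < n by apply: leq_trans n11.
have := card_systems_le_p_count n4; have := s_count_le_triple_systems n.
have := triple_systems_le_four_line_systems n11; lia.
Qed.

(* Passage to the lower limit *)
From mathcomp Require Import all_order all_algebra.
From mathcomp Require Import all_classical all_reals all_analysis.
Import Order.TTheory GRing.Theory Num.Theory.
Local Open Scope ring_scope.
Local Open Scope ereal_scope.

(** The lower limit is the supremum of the tail infima, and the tail from [N] already has infimum at
    least [a]. *)
Lemma limn_einf_ge (R : realType) (u : nat -> \bar R) (a : \bar R) (N : nat) :
  (forall n, (N <= n)%N -> a <= u n) -> a <= limn_einf u.
Proof.
move=> au; rewrite limn_einf_lim (cvg_lim _ (@cvg_einfs_sup _ u)) //.
apply: (@le_trans _ _ (einfs u N)); last by apply: ereal_sup_ubound; exists N.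
by apply: le_ereal_inf_tmp => _ [n Nn <-]; apply: au.
Qed.

Theorem theorem1p6 (R : realType) :
  1%E < limn_einf (fun n : nat => ((p_count n 3)%:R / (s_count n 3)%:R : R)%:E).
Proof.
(* A uniform bound above 1 is inserted, since the strict inequality would not survive the limit. *)
apply: (@lt_le_trans _ _ (193%:R / 192%:R : R)%:E).
  by rewrite lte_fin ltr_pdivlMr ?ltr0n // mul1r ltr_nat.
apply: (@limn_einf_ge _ _ _ 12) => n n12; rewrite lee_fin.
have s0 : (0 < s_count n 3)%N by apply: s_count_gt0; apply: leq_trans n12.
rewrite ler_pdivrMr ?ltr0n // mulrAC ler_pdivlMr ?ltr0n // -!natrM ler_nat.
by rewrite [leqRHS]mulnC; apply: p_count_ge.
Qed.
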